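(* Let $N\ge 2$ be an integer and let $t\ge 0$ be fixed. Let $(A,d)$ be an infinite compact metric space with $\operatorname{diam}(A)<1$, and let $g(s):=\mathcal{E}^s_{\log^t}(A,N)$ for $s\ge 0$. Then $g$ is right differentiable on $[0,\infty)$ and left differentiable on $(0,\infty)$, with $$g'_+(s):=\lim_{r\to s^+}\frac{g(r)-g(s)}{r-s}=\inf G^s_{\log^{t+1}}(A,N),\qquad s\ge 0,$$ and $$g'_-(s):=\lim_{r\to s^-}\frac{g(r)-g(s)}{r-s}=\sup G^s_{\log^{t+1}}(A,N),\qquad s>0.$$
   Context: $\operatorname{diam}(A):=\sup_{x,y\in A}d(x,y)$. An $N$-point configuration is a set $\omega_N\subset A$ of $N$ distinct points. For $s,t\ge 0$ define $$E^s_{\log^t}(\omega_N):=\sum_{\substack{x\ne y\\ x,y\in\omega_N}}\frac{1}{d(x,y)^s}\left(\log\frac{1}{d(x,y)}\right)^t$$ (sum over ordered pairs of distinct points; for $t=0$ the logarithmic factor is $1$), and $$\mathcal{E}^s_{\log^t}(A,N):=\min_{\omega_N\subset A,\ \#\omega_N=N}E^s_{\log^t}(\omega_N);$$ the minimum is attained. Define the set of real numbers $$G^s_{\log^{t+1}}(A,N):=\{E^s_{\log^{t+1}}(\omega_N):\ \omega_N\subset A,\ \#\omega_N=N,\ E^s_{\log^t}(\omega_N)=\mathcal{E}^s_{\log^t}(A,N)\}.$$ *)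

(* Defs.v *)
From HB Require Import structures.
From mathcomp Require Import all_boot all_order all_algebra finmap.
From mathcomp Require Import all_classical all_reals all_analysis.

Set Implicit Arguments.
Unset Strict Implicit.
Unset Printing Implicit Defensive.

Import Order.TTheory GRing.Theory Num.Theory.
Import numFieldNormedType.Exports.

Local Open Scope classical_set_scope.
Local Open Scope ring_scope.

(* Extended-real supremum: it is +oo, not a junk real value, when the
   distances are unbounded. *)
Definition diam (R : realType) (A : metricType R) : \bar R :=
  ereal_sup [set (mdist p.1 p.2)%:E | p in [set: A * A]].

(* N-point configurations are finite sets, hence have N distinct points; the
   metric space is the whole type A. *)
Definition configurations (R : realType) (A : metricType R) (N : nat) :
    set {fset A} :=
  [set w | #|` w| = N].

Arguments configurations {R} A N _.

(* powR satisfies x `^ 0 = 1 for every x, so t = 0 gives logarithmic factor 1. *)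
Definition log_energy (R : realType) (A : metricType R) (s t : R)
    (w : {fset A}) : R :=
  \sum_(x <- w) \sum_(y <- w | x != y)
    1 / mdist x y `^ s * ln (1 / mdist x y) `^ t.

(* The minimal energy. The infimum of a set of reals is its minimum whenever
   the minimum exists, as it does for compact A with diam A < 1, s, t >= 0 and
   at least one configuration. *)
Definition min_log_energy (R : realType) (A : metricType R) (N : nat)
    (s t : R) : R :=
  inf (log_energy s t @` configurations A N).

(* The set G^s_{log^(t+1)}(A,N): the argument is t, and it is the energy with
   exponent t that is minimized. *)
Definition next_log_energies (R : realType) (A : metricType R) (N : nat)
    (s t : R) : set R :=
  log_energy s (t + 1) @`
    [set w | configurations A N w /\
             log_energy s t w = min_log_energy A N s t].

(* Main.v *)
Require Import Defs.
From HB Require Import structures.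
From mathcomp Require Import all_boot all_order all_algebra finmap.
From mathcomp Require Import all_classical all_reals all_analysis.
From mathcomp Require Import lra ring.

Set Implicit Arguments.
Unset Strict Implicit.
Unset Printing Implicit Defensive.

Import Order.TTheory GRing.Theory Num.Theory.
Import numFieldNormedType.Exports.

Local Open Scope classical_set_scope.
Local Open Scope ring_scope.

(** The minimal energy is a lower envelope of functions of the exponent. Writing
    u = ln (1 / d(x, y)), each term of the energy is exp(s u) u^t, so, for a
    fixed configuration, the energy is convex in s and its derivative is the
    same energy with t + 1 in place of t. Since the diameter is less than 1,
    every u is bounded below by a positive constant.

    Let p minimize at s and q at r. The tangent inequality for convex functions
    ([family_energy_tangent]), combined with the two minimality conditions,
    encloses the increment g r - g s between (r - s) E'_s(q) and
    (r - s) E'_r(p), where E'_s is the energy with exponents s and t + 1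
    ([minimizer_increment]). It remains to let r tend to s along minimizers.

    This is done with ultrafilters. If U is an ultrafilter of exponents
    converging to s and w r is a minimizer at r, then compactness makes every
    point of w r converge along U. The limits are distinct because an upper
    bound on an energy that grows without bound near the diagonal keeps the
    points apart ([family_energy_coercive]); the limit p minimizes at s
    ([ultra_minimizer_limit]). Taking this p in the enclosure gives the limit
    E'_s(p) to the quotient, and comparing with any other minimizer at s shows
    that E'_s(p) is the least element of the set G when U approaches s from the
    right, and its greatest one when U approaches s from the left. As U is
    arbitrary, the quotient itself converges ([cvg_ultra]).

    The bound that keeps the points apart differs on the two sides. For r > s it
    is a bound on E'_s(w r), given by the enclosure itself; this covers
    s = t = 0, where the energy E is constant and bounds nothing. For r < s it
    is a bound on the energy E at the fixed exponent s / 2 > 0. *)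

(** * Convergence *)

Lemma ultra_fmap (T V : Type) (f : T -> V) (U : set_system T) :
  UltraFilter U -> UltraFilter (f @ U).
Proof.
move=> UU; split=> [|G GG fUG]; first exact: fmap_proper_filter.
apply/seteqP; split=> // B GB.
have [//|UnB] := in_ultra_setVsetC (f @^-1` B) UU.
have GnB : G (~` B) by apply: fUG.
exfalso; apply: (@filter_not_empty _ G).
by rewrite -(setICr B); exact: filterI.
Qed.

(** If f^-1 B is not in F, then F together with the complement of f^-1 B
    generates a proper filter, and an ultrafilter refining that one contradicts
    the hypothesis. *)
Lemma cvg_ultra (T : Type) (V : topologicalType) (F : set_system T)
    (f : T -> V) (l : V) :
  Filter F ->
  (forall U : set_system T, UltraFilter U -> F `<=` U -> f @ U --> l) ->
  f @ F --> l.
Proof.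
move=> FF Fl B lB; apply: contrapT => nFB.
have GP : ProperFilter (within (~` (f @^-1` B)) F).
  split; last exact: within_filter.
  rewrite /within/= => FnB; apply: nFB.
  by apply: filterS FnB => x /contrapT.
have [U [UU GU]] := ultraFilterLemma GP.
have UnB : U (~` (f @^-1` B)) by apply: GU; rewrite /within/=; apply: filterE.
have FU : F `<=` U.
  by move=> C FC; apply: GU; rewrite /within/=; apply: filterS FC.
have UB : U (f @^-1` B) := Fl U UU FU B lB.
apply: (@filter_not_empty _ U).
by rewrite -(setICr (f @^-1` B)); exact: filterI.
Qed.

Lemma cvg_mdist (R : realType) (A : metricType R) (T : Type)
    (F : set_system T) (f h : T -> A) (x y : A) :
  Filter F -> f @ F --> x -> h @ F --> y ->
  mdist (f z) (h z) @[z --> F] --> mdist x y.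
Proof.
move=> FF fx hy; apply/cvgrPdist_lt => e e0.
have e20 : 0 < e / 2 by rewrite divr_gt0.
have fe := metricType_numDomainType.cvgr_dist_lt fx e20.
have he := metricType_numDomainType.cvgr_dist_lt hy e20.
near=> z.
have fz : mdist x (f z) < e / 2 by near: z; exact: fe.
have hz : mdist y (h z) < e / 2 by near: z; exact: he.
have := metric_triangle x (f z) y; have := metric_triangle (f z) (h z) y.
have := metric_triangle (f z) x (h z); have := metric_triangle x y (h z).
rewrite (metric_sym (f z) x) (metric_sym (h z) y) ltr_norml => *.
by apply/andP; split; lra.
Unshelve. all: by end_near. Qed.

Lemma inf_attained (R : realType) (G : set R) (m : R) :
  G m -> lbound G m -> inf G = m.
Proof.
move=> Gm mG; apply/eqP; rewrite eq_le ge_inf ?lb_le_inf//; first by exists m.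
by exists m.
Qed.

Lemma sup_attained (R : realType) (G : set R) (m : R) :
  G m -> ubound G m -> sup G = m.
Proof.
move=> Gm mG; apply/eqP; rewrite eq_le ge_sup//; last by exists m.
by rewrite ub_le_sup//; exists m.
Qed.

(** * Energies of injective families *)

Definition log_dist (R : realType) (A : metricType R) (x y : A) : R :=
  ln (1 / mdist x y).

(** Indexing the points lets each of them converge separately. The factor
    1 / d^s is written exp(s u), with u the logarithmic distance, which displays
    the dependence on s. *)
Definition family_energy (R : realType) (A : metricType R) (N : nat) (s t : R)
    (p : 'I_N -> A) : R :=
  \sum_(ij : 'I_N * 'I_N | ij.1 != ij.2)
    expR (s * log_dist (p ij.1) (p ij.2)) * log_dist (p ij.1) (p ij.2) `^ t.

Definition minimizer (R : realType) (A : metricType R) (N : nat) (s t : R)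
    (p : 'I_N -> A) : Prop :=
  injective p /\
  forall q : 'I_N -> A, injective q ->
    family_energy s t p <= family_energy s t q.

(** For c = - ln D with D any number in ]0, 1[ that bounds the distances: the
    diameter itself may be 0, hence the maximum with 1/2. *)
Lemma log_dist_lbound (R : realType) (A : metricType R) :
  (diam A < 1)%E ->
  exists2 c : R, 0 < c & forall x y : A, x != y -> c <= log_dist x y.
Proof.
move=> A1.
have dA (x y : A) : ((mdist x y)%:E <= diam A)%E.
  by apply: ereal_sup_ubound; exists (x, y).
have [D [D0 D1 dD]] : exists D : R,
    [/\ 0 < D, D < 1 & forall x y : A, mdist x y <= D].
  move: A1 dA; case: (diam A) => [D| |] //.
  - rewrite lte_fin => D1 dA.
    exists (Num.max D 2^-1); rewrite lt_max gt_max invr_gt0 ltr0n orbT D1.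
    rewrite invf_lt1// ltr1n; split => // x y.
    by rewrite le_max -lee_fin dA.
  - move=> _ dA; exists 2^-1; rewrite invr_gt0 ltr0n invf_lt1// ltr1n.
    by split => // x y; have := dA x y.
exists (- ln D) => [|x y xy]; first by rewrite oppr_gt0 ln_lt0// D0.
have xy0 : 0 < mdist x y by rewrite mdist_gt0.
by rewrite /log_dist div1r lnV ?posrE// lerN2 ler_ln ?posrE.
Qed.

Lemma log_energy_family (R : realType) (A : metricType R) (N : nat)
    (w : {fset A}) (p : 'I_N -> A) :
  injective p -> perm_eq w (map p (enum 'I_N)) ->
  forall s t : R, log_energy s t w = family_energy s t p.
Proof.
move=> pI wp s t; rewrite /log_energy (perm_big _ wp)/= big_map big_enum/=.
rewrite /family_energy -(pair_big_dep xpredT (fun i j => i != j)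
  (fun i j => expR (s * log_dist (p i) (p j)) * log_dist (p i) (p j) `^ t))/=.
apply: eq_bigr => i _; rewrite (perm_big _ wp)/= big_map big_enum_cond/=.
apply: eq_big => [j|j]; first by rewrite (inj_eq pI).
rewrite -mdist_gt0 => ij0; rewrite /log_dist /powR gt_eqF//.
by rewrite !div1r lnV ?posrE// mulrN expRN.
Qed.

Lemma configuration_family (R : realType) (A : metricType R) (N : nat)
    (w : {fset A}) :
  configurations A N w ->
  exists2 p : 'I_N -> A, injective p &
    forall s t : R, log_energy s t w = family_energy s t p.
Proof.
move=> <-; pose p := tnth (in_tuple w).
have pw : map p (enum 'I_(size w)) = w by rewrite map_tnth_enum.
have pI : injective p by apply/tuple_uniqP; exact: fset_uniq.
by exists p => //; apply: log_energy_family => //; rewrite pw.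
Qed.

Lemma family_configuration (R : realType) (A : metricType R) (N : nat)
    (p : 'I_N -> A) :
  injective p ->
  exists2 w : {fset A}, configurations A N w &
    forall s t : R, log_energy s t w = family_energy s t p.
Proof.
move=> pI; pose w := [fset x in map p (enum 'I_N)]%fset.
have wp : perm_eq w (map p (enum 'I_N)).
  apply: uniq_perm => [||x]; first exact: fset_uniq.
    by rewrite map_inj_uniq ?enum_uniq.
  by rewrite inE.
exists w; last exact: log_energy_family.
by rewrite /configurations/= (perm_size wp) size_map size_enum_ord.
Qed.

(** * Minimizers *)

Lemma min_log_energyE (R : realType) (A : metricType R) (N : nat) (s t : R)
    (p : 'I_N -> A) :
  minimizer s t p -> min_log_energy A N s t = family_energy s t p.
Proof.
move=> [pI pmin]; apply: inf_attained.
  by have [w wN wp] := family_configuration pI; exists w.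
move=> _ [w wN <-]; have [q qI ->] := configuration_family wN.
exact: pmin.
Qed.

Lemma next_log_energiesE (R : realType) (A : metricType R) (N : nat) (s t : R)
    (p : 'I_N -> A) :
  minimizer s t p ->
  next_log_energies A N s t =
  family_energy s (t + 1) @` [set q : 'I_N -> A | minimizer s t q].
Proof.
move=> pmin; have gp := min_log_energyE pmin; have [pI ple] := pmin.
apply/seteqP; split.
  move=> _ [w [wN] + <-]; rewrite gp => wmin.
  have [q qI wq] := configuration_family wN.
  exists q; last by rewrite wq.
  by split=> // q' /ple; rewrite -wmin wq.
move=> _ [q qmin <-]; have [w wN wq] := family_configuration qmin.1.
by exists w => //; split => //; rewrite wq (min_log_energyE qmin).
Qed.

Lemma exists_family (R : realType) (A : metricType R) (N : nat) :
  infinite_set [set: A] -> exists p : 'I_N -> A, injective p.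
Proof.
move=> /(infinite_set_fset N)[B _ NB].
have /tuple_uniqP BI : uniq (in_tuple B) := fset_uniq B.
exists (fun i : 'I_N => tnth (in_tuple B) (widen_ord NB i)) => i j.
by move=> /BI/(congr1 val)/=/val_inj.
Qed.

(** * Convexity and growth of the energy *)

(** Termwise, this is 1 + x <= exp x at x = (r - s) u, multiplied by the
    nonnegative number exp(s u) u^t. *)
Lemma family_energy_tangent (R : realType) (A : metricType R) (N : nat)
    (t : R) (p : 'I_N -> A) :
  (diam A < 1)%E -> injective p ->
  forall r s : R,
    family_energy s t p + (r - s) * family_energy s (t + 1) p
    <= family_energy r t p.
Proof.
move=> /log_dist_lbound[c c0 cA] pI r s.
rewrite /family_energy mulr_sumr -big_split/=; apply: ler_sum => -[i j] /= ij.
set u := log_dist _ _.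
have u0 : 0 < u by rewrite (lt_le_trans c0)// cA// (inj_eq pI).
rewrite powRD ?(gt_eqF u0) ?implybT// powRr1 ?(ltW u0)//.
have -> : r * u = s * u + (r - s) * u by ring.
rewrite expRD.
have -> : expR (s * u) * u `^ t + (r - s) * (expR (s * u) * (u `^ t * u)) =
          expR (s * u) * (1 + (r - s) * u) * u `^ t by ring.
by rewrite ler_wpM2r ?powR_ge0// ler_wpM2l ?expR_ge0// expR_ge1Dx.
Qed.

Lemma family_energy_continuous (R : realType) (A : metricType R) (N : nat)
    (t : R) (p : 'I_N -> A) :
  continuous (fun s : R => family_energy s t p).
Proof.
move=> s; apply: cvg_big => [|[i j] _]; first exact: add_continuous.
apply: cvgMl; apply: continuous_cvg; first exact: continuous_expR.
by apply: cvgMl; exact: cvg_id.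
Qed.

Lemma cvg_family_energy_exponent (R : realType) (A : metricType R) (N : nat)
    (F : set_system R) (s t : R) (p : 'I_N -> A) :
  F --> s -> family_energy r t p @[r --> F] --> family_energy s t p.
Proof.
move=> Fs; apply: cvg_trans (@family_energy_continuous _ _ _ t p s).
exact: cvg_app.
Qed.

(** Minimality gives E_s(p) <= E_s(q) and E_r(q) <= E_r(p); the bounds are then
    the tangents at s to the energy of q and at r to the energy of p. *)
Lemma minimizer_increment (R : realType) (A : metricType R) (N : nat)
    (r s t : R) (p q : 'I_N -> A) :
  (diam A < 1)%E -> minimizer s t p -> minimizer r t q ->
  (r - s) * family_energy s (t + 1) q
    <= family_energy r t q - family_energy s t p
    <= (r - s) * family_energy r (t + 1) p.
Proof.
move=> A1 [pI pmin] [qI qmin].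
have := pmin q qI; have := qmin p pI.
have := family_energy_tangent t A1 pI s r.
have := family_energy_tangent t A1 qI r s.
by move=> *; apply/andP; split; lra.
Qed.

Lemma family_energy_ge0 (R : realType) (A : metricType R) (N : nat)
    (s t : R) (p : 'I_N -> A) :
  0 <= family_energy s t p.
Proof. by apply: sumr_ge0 => ij _; rewrite mulr_ge0 ?expR_ge0 ?powR_ge0. Qed.

Lemma family_energy_ler (R : realType) (A : metricType R) (N : nat)
    (t : R) (p : 'I_N -> A) :
  (diam A < 1)%E -> injective p ->
  {homo (fun s : R => family_energy s t p) : r s / r <= s}.
Proof.
move=> A1 pI r s rs; apply: le_trans (family_energy_tangent t A1 pI s r).
by rewrite lerDl mulr_ge0 ?subr_ge0// family_energy_ge0.
Qed.

(** All terms being nonnegative, each exp(s u) u^t is at most M. If s > 0, then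
    s u c^t <= exp(s u) u^t, with c > 0 a lower bound for u; if t > 0, then
    u^t <= exp(s u) u^t. Either inequality bounds u. *)
Lemma family_energy_coercive (R : realType) (A : metricType R) (N : nat)
    (s t M : R) :
  (diam A < 1)%E -> 0 <= s -> 0 <= t -> 0 < s \/ 0 < t ->
  exists B : R, forall p : 'I_N -> A,
    injective p -> family_energy s t p <= M ->
    forall i j, i != j -> log_dist (p i) (p j) <= B.
Proof.
move=> /log_dist_lbound[c c0 cA] s0 t0 st.
suff [B uB] : exists B : R, forall u : R,
    c <= u -> expR (s * u) * u `^ t <= M -> u <= B.
  exists B => p pI pM i j ij; apply: uB; first by rewrite cA ?(inj_eq pI).
  apply: le_trans pM; rewrite /family_energy (bigD1 (i, j))//= lerDl.
  by apply: sumr_ge0 => kl _; rewrite mulr_ge0 ?expR_ge0 ?powR_ge0.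
case: st => [s_gt0|t_gt0].
  exists (M / (s * c `^ t)) => u cu uM.
  have ct0 : 0 < c `^ t by rewrite powR_gt0.
  rewrite ler_pdivlMr ?mulr_gt0//; apply: le_trans uM.
  have u0 : 0 <= u by rewrite (le_trans (ltW c0)).
  have -> : u * (s * c `^ t) = (s * u) * c `^ t by ring.
  apply: ler_pM; rewrite ?powR_ge0 ?mulr_ge0//.
    by apply: le_trans (expR_ge1Dx _); rewrite lerDr.
  by apply: ge0_ler_powR; rewrite ?nnegrE// ltW.
exists (M `^ t^-1) => u cu uM.
have u0 : 0 < u by rewrite (lt_le_trans c0).
have utM : u `^ t <= M.
  apply: le_trans uM; rewrite ler_peMl ?powR_ge0// -expR0 ler_expR.
  by rewrite mulr_ge0// ltW.
rewrite -[leLHS]powRr1 ?(ltW u0)// -(mulfV (lt0r_neq0 t_gt0)) powRrM.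
have M0 : 0 <= M by rewrite (le_trans (powR_ge0 u t)).
by apply: ge0_ler_powR; rewrite ?nnegrE ?invr_ge0 ?powR_ge0.
Qed.

Lemma cvg_family_energy (R : realType) (A : metricType R) (N : nat)
    (T : Type) (F : set_system T) (w : T -> 'I_N -> A) (p : 'I_N -> A) :
  (diam A < 1)%E -> Filter F -> injective p ->
  (forall i, w x i @[x --> F] --> p i) ->
  forall s t : R, family_energy s t (w x) @[x --> F] --> family_energy s t p.
Proof.
move=> A1 FF pI wp s t; apply: cvg_big => [|[i j] /= ij].
  exact: add_continuous.
have [c c0 cA] := log_dist_lbound A1.
have pij : p i != p j by rewrite (inj_eq pI).
have d0 : 0 < mdist (p i) (p j) by rewrite mdist_gt0.
have u0 : 0 < log_dist (p i) (p j) by rewrite (lt_le_trans c0)// cA.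
have uw : log_dist (w x i) (w x j) @[x --> F] --> log_dist (p i) (p j).
  rewrite /log_dist; apply: continuous_cvg.
    by apply: continuous_ln; rewrite divr_gt0.
  apply: cvgMr; apply: cvgV; first by rewrite gt_eqF.
  exact: cvg_mdist.
apply: cvgM.
  apply: continuous_cvg; first exact: continuous_expR.
  exact: cvgMr.
apply: (@continuous_cvg _ _ _ _ _ _ (fun u : R => u `^ t)) => //.
apply: differentiable_continuous; apply/derivable1_diffP.
by apply: derivable_powR; rewrite in_itv/= u0.
Qed.

(** * Compactness *)

(** Each coordinate is an ultrafilter on the compact space, so it converges. The
    bound B survives as a positive lower bound exp(- B) for the distances
    between the limit points. *)
Lemma ultra_family_limit (R : realType) (A : metricType R) (N : nat)
    (T : Type) (U : set_system T) (w : T -> 'I_N -> A) (B : R) :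
  (diam A < 1)%E -> compact [set: A] -> UltraFilter U ->
  (\forall x \near U, injective (w x)) ->
  (\forall x \near U, forall i j, i != j -> log_dist (w x i) (w x j) <= B) ->
  exists2 p : 'I_N -> A, injective p &
    forall s t : R, family_energy s t (w x) @[x --> U] --> family_energy s t p.
Proof.
move=> A1 + UU wI wB; rewrite compact_ultra/= => Ac.
have wi (i : 'I_N) : exists y : A, w x i @[x --> U] --> y.
  have UP : UltraFilter (w x i @[x --> U]) := ultra_fmap _ UU.
  by have [|y [_ wy]] := Ac _ UP; [exact: filterT|exists y].
have [p wp] := choice wi.
have pI : injective p.
  move=> i j pij; apply/eqP; apply: contrapT => /negP ij.
  have : expR (- B) <= mdist (p i) (p j).
    apply: (cvgr_to_ge (cvg_mdist _ (wp i) (wp j))).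
    near=> x.
    have xI : injective (w x) by near: x.
    have : log_dist (w x i) (w x j) <= B.
      by near: x; apply: filterS wB => x; apply.
    have d0 : 0 < mdist (w x i) (w x j) by rewrite mdist_gt0 (inj_eq xI).
    rewrite /log_dist div1r lnV ?posrE// lerNl -ler_expR lnK ?posrE//.
  by rewrite pij mdistxx leNgt expR_gt0.
by exists p => //; exact: cvg_family_energy.
Unshelve. all: by end_near. Qed.

(** A minimizing sequence converges along an ultrafilter finer than the
    cofinite one, unless s = t = 0: the points of the sequence may then collide,
    but all energies are equal. *)
Lemma exists_minimizer (R : realType) (A : metricType R) (N : nat) (s t : R) :
  infinite_set [set: A] -> compact [set: A] -> (diam A < 1)%E ->
  0 <= s -> 0 <= t -> exists p : 'I_N -> A, minimizer s t p.
Proof.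
move=> Ainf Ac A1 s0 t0; have [p0 p0I] := exists_family N Ainf.
(* For s = t = 0 the energy counts the ordered pairs. *)
have [st|] := pselect (0 < s \/ 0 < t); last first.
  move=> /not_orP[/negP + /negP]; rewrite -!leNgt => s_le0 t_le0.
  have {s_le0 s0}-> : s = 0 by apply/eqP; rewrite eq_le s_le0.
  have {t_le0 t0}-> : t = 0 by apply/eqP; rewrite eq_le t_le0.
  exists p0; split=> // q _; rewrite /family_energy.
  by apply: ler_sum => ij _; rewrite !mul0r !powRr0.
pose G : set R :=
  [set family_energy s t p | p in [set p : 'I_N -> A | injective p]].
have Ginf : has_inf G.
  split; first by exists (family_energy s t p0), p0.
  by exists 0 => _ [p _ <-]; exact: family_energy_ge0.
have /choice[w wP] : forall n : nat, exists p : 'I_N -> A,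
    injective p /\ family_energy s t p < inf G + n.+1%:R^-1.
  move=> n.
  have n0 : (0 : R) < n.+1%:R^-1 by rewrite invr_gt0.
  by have [_ [p pI <-] pn] := inf_adherent n0 Ginf; exists p.
have [B wB] := @family_energy_coercive R A N s t (inf G + 1) A1 s0 t0 st.
have [U [UU ooU]] := ultraFilterLemma (eventually_filter).
have [||p pI wp] := @ultra_family_limit R A N nat U w B A1 Ac UU.
- by apply: filterE => n; exact: (wP n).1.
- apply: filterE => n; apply: wB; first exact: (wP n).1.
  by rewrite (le_trans (ltW (wP n).2))// lerD2l invf_le1// ler1n.
exists p; split => // q qI.
apply: (@le_trans _ _ (inf G)); last by apply: ge_inf; [exact: Ginf.2|exists q].
have mU : inf G + n.+1%:R^-1 @[n --> U] --> inf G + 0.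
  apply: cvgD; first exact: cvg_cst.
  by apply: cvg_trans (@cvg_harmonic R); exact: cvg_app.
rewrite -[leRHS]addr0; apply: ler_cvg_to (wp s t) mU _.
by apply: filterE => n; exact: ltW (wP n).2.
Qed.

(** For any competitor q, the tangent inequality and minimality at r bound
    E_s(w r) by E_r(q) - (r - s) E'_s(w r), which tends to E_s(q). *)
Lemma ultra_minimizer_limit (R : realType) (A : metricType R) (N : nat)
    (s t B : R) (U : set_system R) (w : R -> 'I_N -> A) :
  (diam A < 1)%E -> compact [set: A] -> UltraFilter U -> U --> s ->
  (\forall r \near U, minimizer r t (w r)) ->
  (\forall r \near U, forall i j, i != j -> log_dist (w r i) (w r j) <= B) ->
  exists2 p : 'I_N -> A, minimizer s t p &
    family_energy s (t + 1) (w r) @[r --> U] --> family_energy s (t + 1) p.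
Proof.
move=> A1 Ac UU Us wmin wB.
have wI : \forall r \near U, injective (w r) by apply: filterS wmin => r [].
have [p pI wp] := ultra_family_limit A1 Ac UU wI wB.
exists p; last exact: wp.
split=> // q qI.
have qU : family_energy r t q - (r - s) * family_energy s (t + 1) (w r)
    @[r --> U] --> family_energy s t q - (s - s) * family_energy s (t + 1) p.
  apply: cvgB; first exact: cvg_family_energy_exponent.
  apply: cvgM; last exact: wp.
  by apply: cvgB; [exact: Us|exact: cvg_cst].
rewrite -[leRHS]subr0 -(mul0r (family_energy s (t + 1) p)) -(subrr s).
apply: ler_cvg_to (wp s t) qU _.
apply: filterS wmin => r [rI /(_ q qI)].
by have := family_energy_tangent t A1 rI r s; lra.
Qed.

(** * One-sided difference quotients *)

Lemma exists_minimizer_choice (R : realType) (A : metricType R) (N : nat)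
    (t : R) :
  infinite_set [set: A] -> compact [set: A] -> (diam A < 1)%E -> 0 <= t ->
  exists w : R -> 'I_N -> A, forall r, 0 <= r -> minimizer r t (w r).
Proof.
move=> Ainf Ac A1 t0.
suff /choice[w wmin] : forall r : R, exists p : 'I_N -> A,
    0 <= r -> minimizer r t p by exists w.
move=> r; have [r0|r_lt0] := leP 0 r.
  by have [p pmin] := exists_minimizer N Ainf Ac A1 r0 t0; exists p.
by have [p _] := exists_family N Ainf; exists p.
Qed.

Lemma right_quotient_bounds (R : realType) (A : metricType R) (N : nat)
    (r s t : R) (p q : 'I_N -> A) :
  (diam A < 1)%E -> s < r -> minimizer s t p -> minimizer r t q ->
  family_energy s (t + 1) q
    <= (min_log_energy A N r t - min_log_energy A N s t) / (r - s)
    <= family_energy r (t + 1) p.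
Proof.
move=> A1 sr pmin qmin; rewrite (min_log_energyE pmin) (min_log_energyE qmin).
rewrite ler_pdivlMr ?subr_gt0// ler_pdivrMr ?subr_gt0//.
by rewrite ![_ * (r - s)]mulrC; exact: minimizer_increment.
Qed.

Lemma left_quotient_bounds (R : realType) (A : metricType R) (N : nat)
    (r s t : R) (p q : 'I_N -> A) :
  (diam A < 1)%E -> r < s -> minimizer s t p -> minimizer r t q ->
  family_energy r (t + 1) p
    <= (min_log_energy A N r t - min_log_energy A N s t) / (r - s)
    <= family_energy s (t + 1) q.
Proof.
move=> A1 rs pmin qmin; rewrite (min_log_energyE pmin) (min_log_energyE qmin).
rewrite ler_ndivlMr ?subr_lt0// ler_ndivrMr ?subr_lt0// andbC.
by rewrite ![_ * (r - s)]mulrC; exact: minimizer_increment.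
Qed.

Lemma right_quotient_limit (R : realType) (A : metricType R) (N : nat)
    (t s : R) :
  infinite_set [set: A] -> compact [set: A] -> (diam A < 1)%E ->
  0 <= t -> 0 <= s ->
  (min_log_energy A N r t - min_log_energy A N s t) / (r - s) @[r --> s^'+]
    --> inf (next_log_energies A N s t).
Proof.
move=> Ainf Ac A1 t0 s0.
have [w wmin] := exists_minimizer_choice N Ainf Ac A1 t0.
have p0min := wmin s s0; set p0 := w s in p0min.
apply: cvg_ultra => U UU sU.
have Us : U --> s.
  by move=> C sC; apply: sU; apply: (filterS _ sC) => r Cr _.
have rs : \forall r \near U, s < r by apply: sU; exact: nbhs_right_gt.
have rmin : \forall r \near U, minimizer r t (w r).
  by apply: filterS rs => r sr; apply: wmin; rewrite ltW// (le_lt_trans s0).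
have wq (q : 'I_N -> A) : minimizer s t q -> \forall r \near U,
    family_energy s (t + 1) (w r) <=
      (min_log_energy A N r t - min_log_energy A N s t) / (r - s)
      <= family_energy r (t + 1) q.
  move=> qmin; apply: filterS2 rs rmin => r r_s wr.
  exact: right_quotient_bounds.
have cvgE (q : 'I_N -> A) :=
  @cvg_family_energy_exponent R A N U s (t + 1) q Us.
have t10 : 0 < t + 1 by rewrite ltr_wpDl.
have [B wB] := @family_energy_coercive R A N s (t + 1)
  (family_energy s (t + 1) p0 + 1) A1 s0 (ltW t10) (or_intror t10).
(* The exponents s and t + 1 > 0 give a coercive energy even if s = t = 0. The
   slack 1 absorbs the difference between the exponents r and s for p0. *)
have p0U : \forall r \near U,
    family_energy r (t + 1) p0 <= family_energy s (t + 1) p0 + 1.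
  by apply: (cvgr_le _ (cvgE p0)); rewrite ltrDl.
have wsep : \forall r \near U,
    forall i j, i != j -> log_dist (w r i) (w r j) <= B.
  apply: filterS3 rmin p0U (wq p0 p0min) => r [rI _] p0r /andP[wr rp0].
  by apply: wB => //; exact: le_trans wr (le_trans rp0 p0r).
have [p pmin wp] := ultra_minimizer_limit A1 Ac UU Us rmin wsep.
rewrite (next_log_energiesE pmin).
rewrite (@inf_attained _ _ (family_energy s (t + 1) p)).
- exact: squeeze_cvgr (wq p pmin) _ wp (cvgE p).
- by exists p.
- move=> _ [q qmin <-]; apply: ler_cvg_to wp (cvgE q) _.
  by apply: filterS (wq q qmin) => r /andP[]; exact: le_trans.
Qed.

Lemma left_quotient_limit (R : realType) (A : metricType R) (N : nat)
    (t s : R) :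
  infinite_set [set: A] -> compact [set: A] -> (diam A < 1)%E ->
  0 <= t -> 0 < s ->
  (min_log_energy A N r t - min_log_energy A N s t) / (r - s) @[r --> s^'-]
    --> sup (next_log_energies A N s t).
Proof.
move=> Ainf Ac A1 t0 s0.
have [w wmin] := exists_minimizer_choice N Ainf Ac A1 t0.
have [p0I _] := wmin s (ltW s0); set p0 := w s in p0I.
apply: cvg_ultra => U UU sU.
have Us : U --> s.
  by move=> C sC; apply: sU; apply: (filterS _ sC) => r Cr _.
have rs : \forall r \near U, r < s by apply: sU; exact: nbhs_left_lt.
have s20 : 0 < s / 2 by rewrite divr_gt0.
have s2r : \forall r \near U, s / 2 < r.
  by apply: sU; apply: nbhs_left_gt; rewrite gtr_pMr// invf_lt1// ltr1n.
have rmin : \forall r \near U, minimizer r t (w r).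
  by apply: filterS s2r => r sr; apply: wmin; exact: ltW (lt_trans s20 sr).
have wq (q : 'I_N -> A) : minimizer s t q -> \forall r \near U,
    family_energy r (t + 1) q <=
      (min_log_energy A N r t - min_log_energy A N s t) / (r - s)
      <= family_energy s (t + 1) (w r).
  move=> qmin; apply: filterS2 rs rmin => r r_s wr.
  exact: left_quotient_bounds.
have cvgE (q : 'I_N -> A) :=
  @cvg_family_energy_exponent R A N U s (t + 1) q Us.
(* As the energy increases with the exponent, the energy at s / 2 is bounded on
   all the minimizers at r > s / 2; it is coercive because s / 2 > 0. *)
have [B wB] := @family_energy_coercive R A N (s / 2) t (family_energy s t p0)
  A1 (ltW s20) t0 (or_introl s20).
have wsep : \forall r \near U,
    forall i j, i != j -> log_dist (w r i) (w r j) <= B.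
  apply: filterS3 rmin rs s2r => r [rI rle] r_s s2_r.
  apply: wB => //; apply: le_trans (family_energy_ler t A1 rI (ltW s2_r)) _.
  exact: le_trans (rle p0 p0I) (family_energy_ler t A1 p0I (ltW r_s)).
have [p pmin wp] := ultra_minimizer_limit A1 Ac UU Us rmin wsep.
rewrite (next_log_energiesE pmin).
rewrite (@sup_attained _ _ (family_energy s (t + 1) p)).
- exact: squeeze_cvgr (wq p pmin) _ (cvgE p) wp.
- by exists p.
- move=> _ [q qmin <-]; apply: ler_cvg_to (cvgE q) wp _.
  by apply: filterS (wq q qmin) => r /andP[]; exact: le_trans.
Qed.

Theorem theorem2p4 (R : realType) (A : metricType R) (N : nat) (t : R)
    (N_ge2 : (2 <= N)%N) (t_ge0 : 0 <= t)
    (A_infinite : infinite_set [set: A]) (A_compact : compact [set: A])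
    (A_diam : (diam A < 1)%E) :
  let g (s : R) : R := min_log_energy A N s t in
  (forall s : R, 0 <= s ->
     (g r - g s) / (r - s) @[r --> s^'+] --> inf (next_log_energies A N s t))
  /\
  (forall s : R, 0 < s ->
     (g r - g s) / (r - s) @[r --> s^'-] --> sup (next_log_energies A N s t)).
Proof.
by move=> g; split => s s0;
  [exact: right_quotient_limit|exact: left_quotient_limit].
Qed.
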